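(* Let $n\ge 1$ be a natural number and let $L_1,\dots,L_n\colon T\to(-\infty,\infty]$ be functions, none of which is identically equal to $\infty$ on $T$ (that is, for each $j\in\{1,\dots,n\}$ there is $t\in T$ with $L_j(t)<\infty$). Then, for all $u\in\mathbb{R}$, $$ {(L_1\boxplus\cdots\boxplus L_n)^*}^{-1}(u)={L_1^*}^{-1}(u)+\dots+{L_n^*}^{-1}(u), $$ where $L_1\boxplus\cdots\boxplus L_n$ denotes the Hölder convolution of $L_1,\dots,L_n$ and ${L^*}^{-1}$ denotes the (smallest) generalized inverse of the Legendre--Fenchel transform $L^*$ of $L$.
   Context: Let $T:=(0,\infty)$. For a function $L\colon T\to[-\infty,\infty]$, its Legendre--Fenchel transform is $L^*(x):=\sup_{t\in T}[tx-L(t)]\in[-\infty,\infty]$ for $x\in\mathbb{R}$. The (smallest) generalized inverse of $L^*$ is ${L^*}^{-1}(u):=\inf\{x\in\mathbb{R}\colon L^*(x)\ge u\}\in[-\infty,\infty]$ for $u\in\mathbb{R}$, where $\inf\emptyset=\infty$. (If $L$ is not identically $\infty$, then ${L^*}^{-1}(u)<\infty$ for all $u\in\mathbb{R}$, so sums of such values are well defined in $[-\infty,\infty)$.) The Hölder convolution of $L_1,\dots,L_n\colon T\to(-\infty,\infty]$ is the function $L_1\boxplus\cdots\boxplus L_n\colon T\to[-\infty,\infty]$ given by $$(L_1\boxplus\cdots\boxplus L_n)(t):=\inf\Big\{\sum_{j=1}^n\alpha_j L_j\Big(\frac{t}{\alpha_j}\Big)\colon(\alpha_1,\dots,\alpha_n)\in\Sigma_n\Big\},\quad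 t\in T,$$ where $\Sigma_n:=\{(\alpha_1,\dots,\alpha_n)\in(0,\infty)^n\colon\sum_{j=1}^n\alpha_j=1\}$. *)

(* Defs.v *)
From mathcomp Require Import all_boot all_order all_algebra.
From mathcomp Require Import all_classical all_reals all_analysis.

Set Implicit Arguments.
Unset Strict Implicit.
Unset Printing Implicit Defensive.

Import Order.TTheory GRing.Theory Num.Theory.

Local Open Scope classical_set_scope.
Local Open Scope ring_scope.
Local Open Scope ereal_scope.

(* A function on T = (0, oo) is represented by a total function R -> \bar R;
   only its values at positive arguments are ever used. *)

Definition posT (R : realType) : set R := [set t | (0 < t)%R].

Definition legendre_fenchel (R : realType) (L : R -> \bar R) (x : R) : \bar R :=
  ereal_sup [set (t * x)%:E - L t | t in @posT R].

(* The infimum is taken in \bar R, so that the infimum of the empty set is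
   +oo. *)
Definition gen_inv (R : realType) (f : R -> \bar R) (u : R) : \bar R :=
  ereal_inf [set x%:E | x in [set x : R | u%:E <= f x]].

Definition open_simplex (R : realType) (n : nat) : set ('I_n -> R) :=
  [set a | (forall j, (0 < a j)%R) /\ (\sum_(j < n) a j = 1)%R].

(* Since +oo + -oo = -oo by convention in \bar R, the summands are meaningful
   only when the L j do not take the value -oo on (0, oo). *)
Definition holder_conv (R : realType) (n : nat) (L : 'I_n -> R -> \bar R)
    (t : R) : \bar R :=
  ereal_inf [set \sum_(j < n) (a j)%:E * L j (t / a j)%R
            | a in @open_simplex R n].

(* Main.v *)
Require Import Defs.
From mathcomp Require Import all_boot all_order all_algebra.
From mathcomp Require Import all_classical all_reals all_analysis.
From mathcomp Require Import ring lra.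

Import Order.TTheory GRing.Theory Num.Theory.

Set Implicit Arguments.
Unset Strict Implicit.

Local Open Scope classical_set_scope.
Local Open Scope ring_scope.
Local Open Scope ereal_scope.

(** Since [L^*] is nondecreasing, [L^*^-1 u < x] implies [u <= L^* x], while
    [x < L^*^-1 u] implies [L^* x < u].  If [y] exceeds the sum of the
    [L_j^*^-1 u], split [y] into [x_j] exceeding each of them; for [v < u] there
    are [s_j > 0] with [s_j x_j - L_j s_j > v].  Taking [t = 1 / sum_j (1 / s_j)]
    and the weights [a_j = t / s_j], the weighted sum of these inequalities
    bounds the transform of the convolution at [y] below by [v].  If [y] is below
    the sum, the same weighted sum, now over all [t] and all weights, bounds that
    transform at [y] above by some [v < u]. *)

Lemma sum_lt_split {R : realType} (n : nat) (g : 'I_n -> \bar R) (y : R) :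
  (forall j, g j < +oo) -> \sum_(j < n) g j < y%:E ->
  exists2 x : 'I_n -> R, forall j, g j < (x j)%:E & (\sum_(j < n) x j <= y)%R.
Proof.
elim: n g y => [|n IHn] g y gy.
  rewrite big_ord0 lte_fin => y0.
  by exists (fun=> 0%R) => [[]//|]; rewrite big_ord0 ltW.
rewrite big_ord_recl => sy.
set S := \sum_(i < n) _ in sy.
have Sy : S < +oo by apply/lte_sum_pinfty => i _; exact: gy.
(* The slack is shared between the first summand and the tail: halved if both are finite, absorbed
   by the side equal to [-oo] while the other keeps a margin of 1; if both are [-oo], any real will
   do. *)
have [a ga Sa] : exists2 a : R, g ord0 < a%:E & S < (y - a)%:E.
  have := gy ord0; move: sy Sy.
  case: (g ord0) => [r||] //; case: S => [s||] // + _ _.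
  - rewrite -EFinD lte_fin => rs.
    by exists (r + (y - r - s) / 2)%R; rewrite lte_fin; lra.
  - by exists (r + 1)%R; rewrite ?lte_fin ?ltNyr//; lra.
  - by exists (y - s - 1)%R; rewrite ?lte_fin ?ltNyr//; lra.
  - by exists 0%R; rewrite ltNyr.
have [x gx xy] := IHn _ _ (fun i => gy (lift ord0 i)) Sa.
exists (fun j => oapp x a (unlift ord0 j)) => [j|].
  by case: unliftP => [i ->|->] /=.
rewrite big_ord_recl unlift_none /=.
under eq_bigr do rewrite liftK /=.
by rewrite addrC -lerBrDr.
Qed.

(** Negating everything reduces this to [sum_lt_split]. Its finiteness condition is automatic here:
    a single summand [-oo] would make the whole sum [-oo], which exceeds no real. *)
Lemma lt_sum_split {R : realType} (n : nat) (g : 'I_n -> \bar R) (y : R) :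
  y%:E < \sum_(j < n) g j ->
  exists2 x : 'I_n -> R, forall j, (x j)%:E < g j & (y <= \sum_(j < n) x j)%R.
Proof.
move=> yg.
have gNy j : -oo < g j.
  rewrite ltNye; apply/eqP => gj; move: yg.
  suff -> : \sum_(j < n) g j = -oo by [].
  by apply/esum_eqNyP; exists j; rewrite mem_index_enum.
have [||x gx xy] := @sum_lt_split _ _ (fun j => - g j) (- y)%R.
- by move=> j; rewrite lteNl.
- rewrite sumeN; first by rewrite EFinN lteN2.
  by move=> i j _ _; move: (gNy i) (gNy j); case: (g i); case: (g j).
exists (fun j => - x j)%R => [j|]; first by rewrite EFinN lteNl.
by rewrite sumrN lerNr.
Qed.

Lemma lee_lt_real {R : realType} (a b : \bar R) :
  (forall y : R, b < y%:E -> a <= y%:E) -> a <= b.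
Proof.
case: a b => [a||] [b||] // ab; rewrite ?leey ?leNye //.
- by rewrite lee_fin; apply/ler_addgt0Pr => e e0; rewrite -lee_fin ab // lte_fin ltrDl.
- by move/(_ (a - 1)%R (ltNyr (a - 1)%R)): ab; rewrite lee_fin lerBrDr gerDl ler10.
- by have := ab (b + 1)%R; rewrite lte_fin ltrDl ltr01 => /(_ isT).
- by have := ab 0%R (ltNyr 0%R).
Qed.

Lemma gen_inv_lt {R : realType} (f : R -> \bar R) (u x : R) :
  {homo f : x y / (x <= y)%R >-> x <= y} ->
  gen_inv f u < x%:E -> u%:E <= f x.
Proof.
by move=> fh /ereal_inf_lt[_ [z /= uz <-]]; rewrite lte_fin => /ltW/fh/(le_trans uz).
Qed.

Lemma lt_gen_inv {R : realType} (f : R -> \bar R) (u x : R) :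
  x%:E < gen_inv f u -> f x < u%:E.
Proof.
rewrite ltNge => /negP xg; rewrite ltNge; apply/negP => ux.
by apply: xg; apply: ereal_inf_lbound; exists x.
Qed.

Lemma legendre_fenchel_ge {R : realType} (L : R -> \bar R) (x t : R) :
  posT t -> (t * x)%:E - L t <= legendre_fenchel L x.
Proof. by move=> t0; apply: ereal_sup_ubound; exists t. Qed.

Lemma legendre_fenchel_homo {R : realType} (L : R -> \bar R) :
  {homo legendre_fenchel L : x y / (x <= y)%R >-> x <= y}.
Proof.
move=> x y xy; apply: ge_ereal_sup => _ [t t0 <-].
apply: le_trans (legendre_fenchel_ge L y t0).
by rewrite leeD2r // lee_fin ler_wpM2l // ltW.
Qed.

(** For finite [L t], the map sending [x] to [t * x - L t] is affine with positive slope, so it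
    reaches [u]. This supplies the finiteness condition of [sum_lt_split]. *)
Lemma gen_inv_legendre_lty {R : realType} (L : R -> \bar R) (t u : R) :
  posT t -> L t < +oo -> gen_inv (legendre_fenchel L) u < +oo.
Proof.
move=> t0 Lty.
suff [x ux] : exists x : R, u%:E <= (t * x)%:E - L t.
  apply: le_lt_trans (ltry x); apply: ereal_inf_lbound; exists x => //=.
  exact: le_trans ux (legendre_fenchel_ge L x t0).
have tN0 : t != 0%R by rewrite gt_eqF.
case: (L t) Lty => [r||] // _; last by exists 0%R; rewrite addey // leey.
exists ((u + r) / t)%R.
by rewrite -EFinB lee_fin mulrC divfK // addrK.
Qed.

Section holder_conv.
Context {R : realType} {n : nat} (L : 'I_n -> R -> \bar R).

Lemma legendre_holder_conv_ge (x : 'I_n -> R) (v : R) : (1 <= n)%N ->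
  (forall j t, posT t -> -oo < L j t) ->
  (forall j, v%:E < legendre_fenchel (L j) (x j)) ->
  v%:E <= legendre_fenchel (holder_conv L) (\sum_(j < n) x j)%R.
Proof.
move=> n1 LNy vL.
(* [p j] pairs a point where the supremum exceeds [v] with the value of [L j] there; that value is
   finite, since [+oo] would make the difference [-oo]. *)
have /choice[p pP] j : exists p : R * R,
    [/\ (0 < p.1)%R, L j p.1 = p.2%:E & (v < p.1 * x j - p.2)%R].
  have /ereal_sup_gt[_ [s s0 <-]] := vL j.
  have := LNy j s s0.
  case Ljs : (L j s) => [r||] // _.
  by rewrite -EFinB lte_fin => ?; exists (s, r).
pose t := ((\sum_(j < n) (p j).1^-1)^-1)%R.
have t0 : (0 < t)%R.
  (* Here [1 <= n] enters: one strictly positive term makes the sum of inverses positive. *)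
  rewrite invr_gt0 (bigD1 (Ordinal n1)) //= ltr_pwDl //.
    by rewrite invr_gt0; case: (pP (Ordinal n1)).
  by apply: sumr_ge0 => j _; rewrite invr_ge0 ltW //; case: (pP j).
pose a j := (t / (p j).1)%R.
have a0 j : (0 < a j)%R by rewrite divr_gt0 //; case: (pP j).
have a1 : (\sum_(j < n) a j = 1)%R.
  by rewrite -mulr_sumr mulVf // -invr_eq0 gt_eqF.
have Ht : holder_conv L t <= (\sum_(j < n) a j * (p j).2)%R%:E.
  apply: ereal_inf_lbound; exists a => //.
  rewrite -sumEFin; apply: eq_bigr => j _.
  have [p0 Lp _] := pP j.
  have -> : (t / a j = (p j).1)%R by rewrite /a; field; rewrite !gt_eqF.
  by rewrite Lp.
apply: le_trans (legendre_fenchel_ge _ _ t0).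
apply: le_trans (leeB (le_refl _) Ht).
rewrite -EFinB lee_fin mulr_sumr -sumrB.
rewrite -[leLHS]mul1r -a1 mulr_suml; apply: ler_sum => j _.
have [p0 _ vp] := pP j.
have -> : (t * x j = a j * ((p j).1 * x j))%R.
  by rewrite /a mulrA divfK // gt_eqF.
by rewrite -mulrBr ler_wpM2l // ltW.
Qed.

Lemma legendre_holder_conv_le (x : 'I_n -> R) (v : R) :
  (forall j t, posT t -> -oo < L j t) ->
  (forall j, legendre_fenchel (L j) (x j) <= v%:E) ->
  legendre_fenchel (holder_conv L) (\sum_(j < n) x j)%R <= v%:E.
Proof.
move=> LNy Lv; apply: ge_ereal_sup => _ [t t0 <-].
(* Moving the convolution to one side turns the goal into a lower bound on an infimum, checked for
   each choice of weights. *)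
suff: (t * (\sum_(j < n) x j) - v)%R%:E <= holder_conv L t.
  case: (holder_conv L t) => [r||] //; last by rewrite addeNy leNye.
  by rewrite -EFinB !lee_fin; lra.
apply: le_ereal_inf_tmp => _ [a [a0 a1] <-].
(* As the weights sum to 1, [v] is spread over the indices and the inequality splits termwise. *)
rewrite -[v]mul1r -a1 mulr_sumr mulr_suml -sumrB -sumEFin.
apply: lee_sum => j _.
have s0 : posT (t / a j)%R by exact: divr_gt0.
have := le_trans (legendre_fenchel_ge (L j) (x j) s0) (Lv j).
have := LNy j _ s0.
case: (L j _) => [r||] // _; last by rewrite gt0_muley ?lte_fin // leey.
rewrite -EFinB -EFinM !lee_fin -(ler_pM2l (a0 j)) mulrBr !mulrA.
by rewrite [(a j * t)%R]mulrC mulfK ?gt_eqF //; lra.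
Qed.

End holder_conv.

Unset Implicit Arguments.
Set Strict Implicit.

Theorem theorem1p1 (R : realType) (n : nat) (hn : (1 <= n)%N)
  (L : 'I_n -> R -> \bar R)
  (L_gtNy : forall (j : 'I_n) (t : R), posT t -> -oo < L j t)
  (L_proper : forall j : 'I_n, exists2 t : R, posT t & L j t < +oo)
  (u : R) :
  gen_inv (legendre_fenchel (holder_conv L)) u =
  \sum_(j < n) gen_inv (legendre_fenchel (L j)) u.
Proof.
apply/eqP; rewrite eq_le; apply/andP; split.
- apply: lee_lt_real => y /sum_lt_split[j|x gx xy].
    by have [t] := L_proper j; exact: gen_inv_legendre_lty.
  apply: ereal_inf_lbound; exists y => //=.
  apply: le_trans (legendre_fenchel_homo _ xy).
  (* Each transform is only known to be at least [u]; lowering the target to [u - e] gives the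
     strict inequality needed to pick points. *)
  apply/lee_subgt0Pr => e e0.
  apply: legendre_holder_conv_ge => // j.
  apply: (@lt_le_trans _ _ u%:E); first by rewrite lte_fin; lra.
  by apply: gen_inv_lt => //; exact: legendre_fenchel_homo.
- apply: le_ereal_inf_tmp => _ [y /= uy <-].
  rewrite leNgt; apply/negP => /lt_sum_split[x xg yx].
  have /choice[w wP] j : exists w : R,
      legendre_fenchel (L j) (x j) <= w%:E /\ (w < u)%R.
    have := lt_gen_inv (xg j).
    case: legendre_fenchel => [r||] // ru; first by exists r.
    by exists (u - 1)%R; rewrite leNye; split=> //; lra.
  (* A common bound still strictly below [u], as there are finitely many indices and the seed
     [u - 1] is below [u] too. *)
  pose v := (\big[Order.max/(u - 1)]_(j < n) w j)%R.
  have vu : (v < u)%R.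
    by apply: bigmax_lt => [|j _]; [lra|case: (wP j)].
  have Hv : legendre_fenchel (holder_conv L) (\sum_(j < n) x j)%R <= v%:E.
    apply: legendre_holder_conv_le => // j.
    by case: (wP j) => /le_trans + _; apply; rewrite lee_fin le_bigmax.
  have := le_trans uy (le_trans (legendre_fenchel_homo _ yx) Hv).
  by rewrite lee_fin leNgt vu.
Qed.
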